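(* Let $C > 1$ be a fixed real number. Then, as the positive integer $k$ tends to infinity, $$f(k,C) \leq \frac{k}{\ln k}\,(1+o_k(1)),$$ where $f(k,C)$ denotes the minimum possible value of the domatic number $dom(G)$ taken over all $(k,C)$-regular graphs $G$.
   Context: All graphs are finite, undirected and simple. A subset $D$ of vertices of a graph $G$ is a dominating set if every vertex not in $D$ has a neighbor in $D$. The domatic number $dom(G)$ is the maximum number of colors in a (not necessarily proper) vertex coloring of $G$ in which each color class is a dominating set; equivalently, the maximum cardinality of a family of pairwise disjoint dominating sets of $G$. For a positive integer $k$ and a real number $C\ge 1$, a graph $G$ is called $(k,C)$-regular if its minimum degree satisfies $\delta(G)=k$ and its maximum degree satisfies $\Delta(G)\le kC$. $\ln$ is the natural logarithm. $o_k(1)$ denotes a quantity (which may depend on $C$) tending to $0$ as $k\to\infty$ with $C$ fixed. *)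

(* Defs.v *)
From HB Require Import structures.
From mathcomp Require Import all_boot all_order all_algebra.
From mathcomp Require Import all_classical all_reals all_analysis.

Set Implicit Arguments.
Unset Strict Implicit.
Unset Printing Implicit Defensive.

Import Order.TTheory GRing.Theory Num.Theory.

Record sgraph := SGraph {
  vert :> finType;
  adj : rel vert;
  adj_sym : symmetric adj;
  adj_irrefl : irreflexive adj }.

Section Graph.
Variable G : sgraph.

Definition degree (v : G) : nat := #|[set w | adj v w]|.

(* The seed #|G| exceeds every degree, so it is neutral as soon as G has a
   vertex; the empty graph gets minimum degree 0. *)
Definition mindeg : nat := \big[minn/#|G|]_(v : G) degree v.

Definition maxdeg : nat := \max_(v : G) degree v.

Definition dominating (D : {set G}) : bool :=
  [forall v, (v \notin D) ==> [exists w in D, adj v w]].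

Definition domatic_coloring (m : nat) (c : {ffun G -> 'I_m}) : bool :=
  [forall i : 'I_m, dominating [set v | c v == i]].

(* Bounding m by #|G| loses nothing when G has a vertex: dominating sets are
   then nonempty (see leq_domatic). *)
Definition domatic : nat :=
  \max_(m < #|G|.+1 | [exists c : {ffun G -> 'I_m}, domatic_coloring c]) m.

Lemma leq_domatic m (c : {ffun G -> 'I_m}) :
  0 < #|G| -> domatic_coloring c -> m <= domatic.
Proof.
move=> /card_gt0P[v0 _] cP.
have cS : forall i : 'I_m, exists v, c v == i.
  move=> i; have /forallP/(_ v0) := forallP cP i.
  rewrite inE; case: (boolP (c v0 == i)) => [|_ /= /existsP[w]].
    by exists v0.
  by rewrite inE => /andP[? _]; exists w.
have leG : m < #|G|.+1.
  rewrite ltnS -[m in m <= _]card_ord.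
  apply: (@leq_card _ _ (fun i => xchoose (cS i))) => i j eq_ij.
  by rewrite -(eqP (xchooseP (cS i))) eq_ij (eqP (xchooseP (cS j))).
apply: (@leq_bigmax_cond _ _ (fun i : 'I_#|G|.+1 => nat_of_ord i) (Ordinal leG)).
by apply/existsP; exists c.
Qed.

End Graph.

Definition kC_regular (R : realType) (k : nat) (C : R) (G : sgraph) : Prop :=
  mindeg G = k /\ ((maxdeg G)%:R <= k%:R * C)%R.

Definition complete_graph (n : nat) : sgraph :=
  @SGraph 'I_n [rel x y | x != y] (fun x y => congr1 negb (eq_sym x y))
    (fun x => congr1 negb (eqxx x)).

Lemma complete_degree n (v : complete_graph n.+1) : degree v = n.
Proof.
transitivity #|predC1 v|; last by rewrite cardC1 card_ord.
by apply: eq_card => w; rewrite !inE /= eq_sym.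
Qed.

Lemma complete_kC_regular (R : realType) (k : nat) (C : R) :
  (1 <= C)%R -> kC_regular k C (complete_graph k.+1).
Proof.
move=> C1; split.
  rewrite /mindeg (eq_bigr (fun=> k)) => [|v _]; last exact: complete_degree.
  rewrite big_const /= !card_ord iterS; apply/minn_idPl.
  by elim: {2}k => [|m IHm] /=; rewrite ?leqnSn // leq_min leqnn.
apply: (@le_trans _ _ k%:R%R); last by rewrite ler_peMr.
rewrite ler_nat; apply/bigmax_leqP => v _; by rewrite complete_degree.
Qed.

Lemma ex_domatic_kC_regular (R : realType) (k : nat) (C : R) (hC : (1 <= C)%R) :
  exists d, `[< exists G, kC_regular k C G /\ domatic G = d >].
Proof.
exists (domatic (complete_graph k.+1)); apply/asboolP.
by exists (complete_graph k.+1); split=> //; exact: complete_kC_regular.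
Qed.

Definition min_domatic (R : realType) (k : nat) (C : R) (hC : (1 <= C)%R) : nat :=
  ex_minn (ex_domatic_kC_regular k hC).

(* Main.v *)
(* Take the disjoint union A of k cliques of size k+1 and add an independent set
   B of about (C-1)k^2/3 vertices, each joined to a uniformly random k-subset of
   A.  Vertices of B have degree k; those of A have degree at least k, and at
   most k + (C-1)k with high probability, because on average they receive only
   about (C-1)k/3 neighbours in B.  A set S of at most (1-2g) k ln k vertices of
   A misses a random k-subset with probability at least p = k^(g-1), so that with
   high probability every such S leaves more than p|B|/4 vertices of B without a
   neighbour in S.  As B is independent, each colour class of a domatic colouring
   then has more than (1-2g) k ln k vertices in A or more than p|B|/4 in B.  The
   first kind occurs at most about k / ((1-2g) ln k) times, and the second at
   most 4 k^(1-g) = o(k / ln k) times. *)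
Require Import Defs.
From HB Require Import structures.
From mathcomp Require Import all_boot all_order all_algebra.
From mathcomp Require Import all_classical all_reals all_analysis.
From mathcomp Require Import ring lra.

Set Implicit Arguments.
Unset Strict Implicit.
Unset Printing Implicit Defensive.

Import Order.TTheory GRing.Theory Num.Theory.
Import numFieldNormedType.Exports.

(** * Random neighbourhoods by the first-moment method *)

(* First-moment method: if the [h b] are independent and uniform on [W], the
   left-hand side is [#|W| ^+ #|B|] times the expectation of the sum of all
   [c i * r i ^+ #|[set b | P i (h b)]|]. *)
Lemma ex_choice_counts (R : realFieldType) (B T I : finType) (W : {set T})
    (P : I -> pred T) (c r : I -> R) :
  (forall i, 0 <= c i)%R -> (forall i, 0 <= r i)%R ->
  (\sum_i c i * (#|W|%:R + (r i - 1) * #|[set x in W | P i x]|%:R) ^+ #|B|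
     < #|W|%:R ^+ #|B|)%R ->
  exists2 h : {ffun B -> T}, (forall b, h b \in W) &
    forall i, (c i * r i ^+ #|[set b | P i (h b)]| < 1)%R.
Proof.
move=> c0 r0 small; apply: contrapT => noh.
pose w i x : R := if P i x then r i else 1%R.
have w0 i x : (0 <= w i x)%R by rewrite /w; case: ifP.
have sum_w i : (\sum_(x in W) w i x =
    #|W|%:R + (r i - 1) * #|[set x in W | P i x]|%:R)%R.
  rewrite (eq_bigr (fun x => 1 + (if P i x then r i - 1 else 0)))%R; last first.
    by move=> x _; rewrite /w; case: ifP => _; ring.
  rewrite big_split /= sumr_const; congr (_ + _)%R.
  rewrite -big_mkcondr /= sumr_const mulr_natr; congr (_ *+ _)%R.
  by apply: eq_card => x; rewrite !inE.
have prod_w i (h : {ffun B -> T}) :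
    (\prod_b w i (h b) = r i ^+ #|[set b | P i (h b)]|)%R.
  rewrite /w -big_mkcond /= prodr_const; congr (_ ^+ _)%R.
  by apply: eq_card => x; rewrite inE.
move: small; apply/negP; rewrite -leNgt.
(* Expanding the powers gives a sum over all [h] with values in [W]; each fails at some [i], hence
   contributes at least 1. *)
under eq_bigr => i _.
  rewrite -sum_w -prodr_const (bigA_distr_big (mem W) (fun _ => w i)) big_distrr /=.
  over.
rewrite exchange_big /= -natrX -card_ffun_on -sumr_const.
apply: ler_sum => h /ffun_onP hW.
have [i hi] : exists i, (1 <= c i * r i ^+ #|[set b | P i (h b)]|)%R.
  apply: contrapT => noi; apply: noh; exists h => // i.
  by rewrite ltNge; apply/negP => hi; apply: noi; exists i.
rewrite (bigD1 i) //= prod_w -[leLHS]addr0; apply: lerD => //.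
by apply: sumr_ge0 => j _; rewrite mulr_ge0 ?prodr_ge0.
Qed.

Lemma card_draws_disjoint (T : finType) (S : {set T}) (k : nat) :
  #|[set X : {set T} | #|X| == k & [disjoint X & S]]| = 'C(#|T| - #|S|, k).
Proof.
rewrite -{2}(finset.setCK S) -cardsCs -cards_draws; apply: eq_card => X.
by rewrite !inE finset.disjoints_subset andbC.
Qed.

Lemma card_draws_mem (T : finType) (x : T) (k : nat) :
  #|T| * #|[set X : {set T} | #|X| == k & x \in X]| = k * 'C(#|T|, k).
Proof.
have Tgt0 : 0 < #|T| by apply/card_gt0P; exists x.
have /eqP : #|[set X : {set T} | #|X| == k & x \in X]| + 'C(#|T|.-1, k) =
    'C(#|T|, k).
  rewrite -subn1 -(cards1 x) -card_draws_disjoint -card_draws.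
  rewrite -[RHS](cardsID [set X : {set T} | x \in X]).
  by congr (_ + _); apply: eq_card => X; rewrite !inE // disjoint_sym disjoints1 andbC.
case: k => [|k]; last rewrite -mul_bin_diag.
  by rewrite !bin0 mul0n -[X in _ == X]add0n eqn_add2r => /eqP ->; rewrite muln0.
by move: Tgt0; case: #|T| => // n _; rewrite [n.+1.-1]/= binS addnC eqn_add2l => /eqP ->.
Qed.

(** The summands are exponential moments for independent uniform [k]-sets: weight [2] per set
    containing a given vertex, weight [2^-1] per set missing a given [S]. *)
Lemma ex_neighbourhoods (R : realFieldType) (A : finType) (k d s u N : nat) (p : R) :
  0 < k <= #|A| -> (p <= 1)%R ->
  (p * 'C(#|A|, k)%:R <= 'C(#|A| - s, k)%:R)%R ->
  (#|A|%:R * 2^-1 ^+ d * (1 + k%:R / #|A|%:R) ^+ N +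
   #|A|%:R ^+ s * 2 ^+ u * (1 - p / 2) ^+ N < 1)%R ->
  exists h : {ffun 'I_N -> {set A}},
    [/\ forall b, #|h b| = k,
        forall x, #|[set b | x \in h b]| < d &
        forall S : {set A}, #|S| <= s -> u < #|[set b | [disjoint h b & S]]|].
Proof.
move=> /andP[k0 kA] p1 hp small.
have /card_gt0P[x0 _] : 0 < #|A| by exact: leq_trans kA.
have A0 : (#|A|%:R != 0 :> R)%R by rewrite pnatr_eq0 -lt0n; exact: leq_trans kA.
pose W := [set X : {set A} | #|X| == k].
have W0 : (0 < #|W|%:R :> R)%R by rewrite ltr0n card_draws bin_gt0.
(* Sets of at most [s] elements are replaced by images of functions on ['I_s], whence the factor
   [#|A| ^ s]. *)
pose P (i : A + {ffun 'I_s -> A}) (X : {set A}) :=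
  match i with inl x => x \in X | inr f => [disjoint X & codom f] end.
pose c (i : A + {ffun 'I_s -> A}) : R :=
  match i with inl _ => 2^-1 ^+ d | inr _ => 2 ^+ u end%R.
pose r (i : A + {ffun 'I_s -> A}) : R :=
  match i with inl _ => 2 | inr _ => 2^-1 end%R.
have sum_cst (J : finType) (z : R) : (#|J|%:R * z = \sum_(j : J) z)%R.
  by rewrite sumr_const mulr_natl.
case: (@ex_choice_counts R 'I_N _ _ W P c r).
- by case=> ? /=; rewrite exprn_ge0.
- by case=> ? /=.
- rewrite card_ord.
  apply: (@le_lt_trans _ _ ((#|A|%:R * 2^-1 ^+ d * (1 + k%:R / #|A|%:R) ^+ N +
     #|A|%:R ^+ s * 2 ^+ u * (1 - p / 2) ^+ N) * #|W|%:R ^+ N)%R); last first.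
    by rewrite -[ltRHS]mul1r ltr_pM2r // exprn_gt0.
  rewrite big_sumType /= mulrDl; apply: lerD.
    rewrite -!mulrA -exprMn sum_cst; apply: ler_sum => x _.
    rewrite le_eqVlt; apply/orP; left; apply/eqP; congr (_ * _ ^+ _)%R.
    have /(congr1 (fun n => n%:R : R)%R) := card_draws_mem x k.
    rewrite -card_draws -/W !natrM => e.
    have -> : [set X in W | x \in X] = [set X : {set A} | #|X| == k & x \in X].
      by apply/setP => X; rewrite !inE.
    by apply: (mulfI A0); rewrite mulrDr mulrCA e; field.
  rewrite -!mulrA -exprMn -(natrX _ #|A|).
  have <- : #|{ffun 'I_s -> A}| = #|A| ^ s by rewrite card_ffun card_ord.
  rewrite sum_cst; apply: ler_sum => f _.
  rewrite ler_wpM2l ?exprn_ge0 // lerXn2r ?nnegrE //.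
  + have : (#|[set x in W | [disjoint x & codom f]]|%:R <= #|W|%:R :> R)%R.
      by rewrite ler_nat subset_leq_card //; apply/fintype.subsetP => X; rewrite inE => /andP[].
    by lra.
  + by rewrite mulr_ge0 ?ltW //; lra.
  have cf : #|[set x in codom f]| <= s.
    by rewrite cardsE (leq_trans (leq_image_card _ _)) // card_ord.
  have : (p * #|W|%:R <= #|[set x in W | [disjoint x & codom f]]|%:R)%R.
    rewrite card_draws (le_trans hp) // ler_nat.
    have -> : [set x in W | [disjoint x & codom f]] =
        [set X : {set A} | #|X| == k & [disjoint X & [set x in codom f]]].
      apply/setP => X; rewrite !inE; congr andb.
      by apply: eq_disjoint_r => y; rewrite inE.
    by rewrite card_draws_disjoint leq_bin2l // leq_sub2l.
  by lra.
move=> h hW hP; exists h; split.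
- by move=> b; apply/eqP; move: (hW b); rewrite inE.
- move=> x; have := hP (inl x); rewrite /= exprVn mulrC.
  by rewrite ltr_pdivrMr ?exprn_gt0 // mul1r ltr_eXn2l // ltr1n.
(* Padding with [x0] may enlarge the image beyond [S], but a set disjoint from the image is still
   disjoint from [S]. *)
move=> S Ss; pose f : {ffun 'I_s -> A} := [ffun i : 'I_s => nth x0 (enum S) i].
have Sf : S \subset codom f.
  apply/fintype.subsetP => y yS; have yi : index y (enum S) < s.
    by rewrite (leq_trans _ Ss) // cardE index_mem mem_enum.
  apply/codomP; exists (Ordinal yi); rewrite ffunE nth_index // mem_enum //.
have := hP (inr f); rewrite /= exprVn.
rewrite ltr_pdivrMr ?exprn_gt0 // mul1r ltr_eXn2l ?ltr1n // => /leq_trans; apply.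
apply: subset_leq_card; apply/fintype.subsetP => b; rewrite !inE.
by move=> /disjointWr; apply.
Qed.

(** * Degrees and domatic number of the constructed graph *)

Lemma card_large_fibres (T : finType) (m t : nat) (f : T -> 'I_m) :
  #|[set i | t < #|[set x | f x == i]|]| <= #|T| %/ t.+1.
Proof.
rewrite leq_divRL // -sum_nat_const -[leqRHS]sum1_card.
rewrite (partition_big f xpredT) //= [leqRHS](bigID (mem [set i | t < #|[set x | f x == i]|])) /=.
rewrite (leq_trans _ (leq_addr _ _)) //; apply: leq_sum => i; rewrite inE => /leq_trans; apply.
by rewrite sum1_card; apply/eq_leq/eq_card => x; rewrite !inE.
Qed.

Lemma card_sum_pred (T1 T2 : finType) (P : pred (T1 + T2)) :
  #|P| = #|[pred x | P (inl x)]| + #|[pred x | P (inr x)]|.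
Proof. by rewrite -!sum1_card big_sumType. Qed.

Lemma mindeg_le (G : sgraph) (v : G) : mindeg G <= degree v.
Proof.
rewrite /mindeg; elim: (index_enum _) (mem_index_enum v) => // w r IHr.
rewrite big_cons inE => /orP[/eqP <-|/IHr]; first exact: geq_minl.
by apply: leq_trans; exact: geq_minr.
Qed.

Section PendantGraph.
Variables (k N : nat) (h : {ffun 'I_N -> {set 'I_k * 'I_k.+1}}).

(* Disjoint cliques of size [k.+1] on ['I_k * 'I_k.+1], which give these vertices
   degree at least [k], and independent vertices [b] attached to [h b]. *)
Definition pendant_adj (v w : ('I_k * 'I_k.+1) + 'I_N) : bool :=
  match v, w with
  | inl x, inl y => (x.1 == y.1) && (x.2 != y.2)
  | inl x, inr b | inr b, inl x => x \in h b
  | inr _, inr _ => false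
  end.

Lemma pendant_adj_sym : symmetric pendant_adj.
Proof. by move=> [x|b] [y|b'] //=; rewrite [x.1 == _]eq_sym [x.2 == _]eq_sym. Qed.

Lemma pendant_adj_irrefl : irreflexive pendant_adj.
Proof. by move=> [x|b] //=; rewrite !eqxx. Qed.

Definition pendant_graph : sgraph := SGraph pendant_adj_sym pendant_adj_irrefl.

Lemma degree_pendant_inl (x : 'I_k * 'I_k.+1) :
  degree (inl x : pendant_graph) = k + #|[set b | x \in h b]|.
Proof.
rewrite /degree cardsE card_sum_pred; congr (_ + _); last first.
  by rewrite -cardsE; apply: eq_card => b; rewrite !inE.
transitivity #|finset.setX [set x.1] [set~ x.2]|.
  by apply: eq_card => y; rewrite !inE /= eq_sym [x.2 == _]eq_sym.
by rewrite cardsX cards1 cardsC1 card_ord mul1n.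
Qed.

Lemma degree_pendant_inr (b : 'I_N) : degree (inr b : pendant_graph) = #|h b|.
Proof.
rewrite /degree cardsE card_sum_pred [X in _ + X]eq_card0 ?addn0 //.
Qed.

Lemma kC_regular_pendant (R : realType) (C : R) (d : nat) :
  0 < N -> (forall b, #|h b| = k) -> (forall x, #|[set b | x \in h b]| <= d) ->
  (1 <= C)%R -> (d%:R <= k%:R * (C - 1))%R -> kC_regular k C pendant_graph.
Proof.
move=> N0 hk hd C1 dC; split.
  (* A vertex of B brings the minimum degree down to exactly [k]; those of A might all exceed it. *)
  pose v0 : pendant_graph := inr (Ordinal N0).
  have dv0 : degree v0 = k by rewrite degree_pendant_inr.
  apply/eqP; rewrite eqn_leq -{1}dv0 mindeg_le /=.
  apply: (big_ind (fun n => k <= n)).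
  - by rewrite -dv0 max_card.
  - by move=> m n km kn; rewrite leq_min km.
  - by case=> [x|b] _; rewrite ?degree_pendant_inl ?leq_addr // degree_pendant_inr hk.
apply: (@le_trans _ _ (k + d)%:R%R); last by rewrite natrD; lra.
rewrite ler_nat; apply/bigmax_leqP; case=> [x|b] _.
  by rewrite degree_pendant_inl leq_add2l.
by rewrite degree_pendant_inr hk leq_addr.
Qed.

(** A class with at most [s] vertices in A must itself contain every vertex of B whose neighbourhood
    it misses, since B is independent. *)
Lemma domatic_pendant_le (s u : nat) :
  (forall S : {set 'I_k * 'I_k.+1}, #|S| <= s ->
     u < #|[set b | [disjoint h b & S]]|) ->
  domatic pendant_graph <= (k * k.+1) %/ s.+1 + N %/ u.+1.
Proof.
move=> hS; apply/bigmax_leqP => -[m /= _] /existsP[c /forallP cP].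
pose c1 x := c (inl x); pose c2 b := c (inr b).
pose I1 := [set i | s < #|[set x | c1 x == i]|].
pose I2 := [set i | u < #|[set b | c2 b == i]|].
have cover_I : [set: 'I_m] \subset I1 :|: I2.
  apply/fintype.subsetP => i _; rewrite !inE -implyNb -leqNgt; apply/implyP => le_s.
  apply: leq_trans (hS _ le_s) _; apply: subset_leq_card; apply/fintype.subsetP => b.
  rewrite !inE => dis; apply: contraT => ci.
  have /forallP/(_ (inr b)) := cP i; rewrite inE ci /= => /existsP[[x|b'] /=].
    rewrite inE => /andP[cx xb]; move/pred0P: dis => /(_ x) /=.
    by rewrite xb inE cx.
  by rewrite andbF.
rewrite -[m in m <= _]card_ord -cardsT (leq_trans (subset_leq_card cover_I)) //.
rewrite (leq_trans (leq_card_setU _ _)) // leq_add //.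
  by rewrite (leq_trans (card_large_fibres _ _)) // card_prod !card_ord.
by rewrite (leq_trans (card_large_fibres _ _)) // card_ord.
Qed.

End PendantGraph.

(** * Binomial and exponential estimates *)

(** The ratio of the binomials is the product over [i < k] of [1 - s / (a - i)], where
    [a - i >= a - k]. *)
Lemma bin_sub_ge (R : realFieldType) (a s k : nat) (x : R) :
  k <= a -> (0 <= x <= 1)%R -> (s%:R <= x * (a - k)%:R)%R ->
  ((1 - x) ^+ k * 'C(a, k)%:R <= 'C(a - s, k)%:R)%R.
Proof.
move=> ka /andP[x0 x1] sx.
have kfact0 : (0 < k`!%:R :> R)%R by rewrite ltr0n fact_gt0.
rewrite -(ler_pM2r kfact0) -mulrA -!natrM !bin_ffact !ffact_prod !natr_prod.
rewrite -[X in (_ ^+ X)%R](card_ord k) -prodr_const -big_split /=.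
apply: ler_prod => i _; rewrite mulr_ge0 ?subr_ge0 //=.
have ai : (a - k <= a - i)%N by rewrite leq_sub2l // ltnW.
have sxi : (s%:R <= x * (a - i)%:R)%R.
  by rewrite (le_trans sx) // ler_wpM2l // ler_nat.
have sai : (s <= a - i)%N.
  by rewrite -(ler_nat R) (le_trans sxi) // ler_piMl.
rewrite subnAC (natrB _ sai); lra.
Qed.

Section ExponentialBounds.
Variable R : realType.
Implicit Types x y : R.
Local Open Scope ring_scope.

(** Invert [1 / (1 - x) = 1 + x / (1 - x) <= expR (x / (1 - x))] and take [k]-th powers. *)
Lemma onem_expR_ge x (k : nat) : 0 <= x < 1 ->
  expR (- (k%:R * x / (1 - x))) <= (1 - x) ^+ k.
Proof.
move=> /andP[x0 x1]; have x1' : 0 < 1 - x by lra.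
rewrite -mulrA -mulrN expRM_natl; apply: lerXn2r; rewrite ?nnegrE ?expR_ge0 ?(ltW x1') //.
rewrite expRN.
rewrite -[leRHS]invrK lef_pV2 ?posrE ?expR_gt0 ?invr_gt0 //.
apply: le_trans (expR_ge1Dx _); rewrite le_eqVlt; apply/orP; left; apply/eqP.
by field; rewrite gt_eqF.
Qed.

Lemma half_le_expR : 2^-1 <= expR (- 2^-1 : R).
Proof. by have := expR_ge1Dx (- 2^-1 : R); lra. Qed.

Lemma two_le_expR1 : 2 <= expR (1 : R).
Proof. by have := expR_ge1Dx (1 : R); lra. Qed.

(** With cap [3 * q] at three times the mean [q], the exponents [- 3 * q / 2] and [q] add up to
    [- q / 2]. *)
Lemma overload_weight_le (q n : nat) : (0 < n)%N ->
  2^-1 ^+ (3 * q) * (1 + n%:R^-1) ^+ (q * n) <= expR (- (q%:R / 2)) :> R.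
Proof.
move=> n0; have n0' : n%:R != 0 :> R by rewrite pnatr_eq0 -lt0n.
have h1 : (1 + n%:R^-1) ^+ (q * n) <= expR q%:R :> R.
  rewrite -[q%:R](mulfK n0') -natrM expRM_natl; apply: lerXn2r.
  - by rewrite nnegrE addr_ge0 ?invr_ge0.
  - by rewrite nnegrE expR_ge0.
  - exact: expR_ge1Dx.
have h2 : 2^-1 ^+ (3 * q) <= expR ((3 * q)%:R * - 2^-1) :> R.
  by rewrite expRM_natl; apply: lerXn2r; rewrite ?nnegrE ?expR_ge0 ?half_le_expR.
apply: le_trans (ler_pM _ _ h2 h1) _.
- by rewrite exprn_ge0.
- by rewrite exprn_ge0 // addr_ge0 ?invr_ge0.
by rewrite -expRD ler_expR natrM; lra.
Qed.

Lemma missing_weight_le (s u N : nat) (a l p : R) :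
  0 <= a -> a <= expR l -> 0 <= p -> p <= 1 ->
  a ^+ s * 2 ^+ u * (1 - p / 2) ^+ N
    <= expR (s%:R * l + u%:R - p * N%:R / 2).
Proof.
move=> a0 al p0 p1; have p2 : 0 <= 1 - p / 2 by lra.
have -> : s%:R * l + u%:R - p * N%:R / 2 =
    s%:R * l + u%:R * 1 + N%:R * - (p / 2) by lra.
rewrite !expRD !expRM_natl.
apply: ler_pM; rewrite ?mulr_ge0 ?exprn_ge0 //.
  apply: ler_pM; rewrite ?exprn_ge0 //;
    by apply: lerXn2r; rewrite ?nnegrE ?expR_ge0 ?two_le_expR1.
apply: lerXn2r => //; first by rewrite nnegrE expR_ge0.
exact: expR_ge1Dx.
Qed.

End ExponentialBounds.

Local Open Scope classical_set_scope.
Local Open Scope ring_scope.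

(** * Choice of parameters and the bound for a given [k] *)

(** The constant [M] absorbs the dependence on [C] and [g]; the last hypothesis,
    [k^g >= M (ln k)^2], is how large [k] must be. *)
Lemma min_domatic_ln_le (R : realType) (C g M : R) (hC : 1 < C) (k : nat) :
  0 < g <= 8^-1 -> 20 <= (C - 1) / 6 * M -> 4 <= g * M -> 1 <= ln (k%:R : R) ->
  M * ln (k%:R : R) ^+ 2 <= expR (g * ln k%:R) ->
  (min_domatic k (ltW hC))%:R * ln k%:R <= k%:R * (1 + 6 * g) :> R.
Proof.
move=> /andP[g0 g8] cM gM L1 ML.
set L := ln _ in L1 ML *; set c := (C - 1) / 6 in cM.
set K : R := k%:R in L ML L1 *.
have k0 : (0 < k)%N.
  by rewrite lt0n; apply/eqP => k0; move: L1; rewrite /L /K k0 ln0 ?ler10.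
have K0 : 0 < K by rewrite ltr0n.
have c0 : 0 < c by rewrite /c; lra.
have M0 : 0 < M by rewrite -(pmulr_rgt0 _ g0); lra.
have KE : expR L = K by rewrite lnK // posrE.
have KML : M * L ^+ 2 <= K.
  by rewrite (le_trans ML) // -KE ler_expR; nra.
have ML0 : M * L <= M * L ^+ 2 by rewrite expr2 mulrA ler_peMr //; nra.
have gK : 4 * L <= g * K.
  have : g * (M * L) <= g * K by rewrite ler_pM2l //; lra.
  by nra.
have cK : 20 * L <= c * K.
  have : c * (M * L) <= c * K by rewrite ler_pM2l //; lra.
  by nra.
pose q := Num.truncn ((C - 1) * K / 3).
have q_le : q%:R <= (C - 1) * K / 3.
  by rewrite truncn_le divr_ge0 // mulr_ge0 //; lra.
have q_ge : c * K <= q%:R :> R.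
  have := truncnS_gt ((C - 1) * K / 3); rewrite -/q -[q.+1%:R]natr1.
  have -> : (C - 1) * K / 3 = 2 * (c * K) by rewrite /c; field.
  by lra.

(* This makes the mean number of B-neighbours of a vertex of A, [N * k / (k * k.+1)], exactly
   [q]. *)
pose N := (q * k.+1)%N.
have NE : N%:R = q%:R * (K + 1) :> R by rewrite natrM -natr1.
have N_ge : c * K ^+ 2 <= N%:R by rewrite NE expr2; nra.
have N0 : (0 < N)%N.
  by rewrite -(ltr_nat R); apply: lt_le_trans N_ge; rewrite mulr_gt0 ?exprn_gt0.
pose s := Num.truncn ((1 - 2 * g) * K * L).
have s_le : s%:R <= (1 - 2 * g) * K * L.
  by rewrite truncn_le !mulr_ge0 //; lra.
have s_gt : (1 - 2 * g) * K * L < s.+1%:R by exact: truncnS_gt.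
(* This is [k^(g-1)]. *)
pose p := expR (- ((1 - g) * L)).
have p0 : 0 < p by exact: expR_gt0.
have pK : p * K = expR (g * L) by rewrite -KE -expRD; congr expR; lra.
have p1 : p <= 1.
  by rewrite -[leRHS]expR0 ler_expR oppr_le0 mulr_ge0 //; lra.
have pN : 20 * (K * L ^+ 2) <= p * N%:R.
  have : p * (c * K ^+ 2) <= p * N%:R by rewrite ler_pM2l.
  have -> : p * (c * K ^+ 2) = c * K * (p * K) by ring.
  have : c * K * (M * L ^+ 2) <= c * K * (p * K).
    by rewrite pK ler_pM2l // mulr_gt0.
  have -> : c * K * (M * L ^+ 2) = c * M * (K * L ^+ 2) by ring.
  have : 20 * (K * L ^+ 2) <= c * M * (K * L ^+ 2).
    by rewrite ler_wpM2r // mulr_ge0 ?exprn_ge0 //; lra.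
  by lra.
pose u := Num.truncn (p * N%:R / 4).
have u_le : u%:R <= p * N%:R / 4.
  by rewrite truncn_le divr_ge0 // mulr_ge0 // ltW.
have u_gt : p * N%:R / 4 < u.+1%:R by exact: truncnS_gt.
pose A := ('I_k * 'I_k.+1)%type.
have cardA : #|{: A}| = (k * k.+1)%N by rewrite card_prod !card_ord.
have AE : (k * k.+1)%:R = K * (K + 1) :> R by rewrite natrM -natr1.
have hp : p * 'C(#|{: A}|, k)%:R <= 'C(#|{: A}| - s, k)%:R.
  (* The denominator is [#|A| - k = k * k.+1 - k = k^2]. *)
  rewrite cardA; set x : R := s%:R / K ^+ 2.
  have xK2 : x * K ^+ 2 = s%:R by rewrite /x divfK // expf_neq0 // gt_eqF.
  have xK : x * K <= (1 - 2 * g) * L.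
    by rewrite -(ler_pM2r K0) -mulrA -expr2 xK2 mulrAC.
  have x0 : 0 <= x by rewrite divr_ge0 // exprn_ge0 // ltW.
  have xg : x <= g by rewrite -(ler_pM2r K0); nra.
  (* The slack between [1 - 2g] and [1 - g] pays for the denominator [1 - x]: since [x <= g],
     [(1 - g)(1 - x) >= (1 - g)^2 >= 1 - 2g]. *)
  have px : p <= (1 - x) ^+ k.
    apply: le_trans (onem_expR_ge k _); last by rewrite x0 /=; lra.
    rewrite ler_expR lerN2 ler_pdivrMr; last by lra.
    rewrite -/K mulrC (le_trans xK) //.
    rewrite mulrAC ler_wpM2r //; nra.
  apply: (@le_trans _ _ ((1 - x) ^+ k * 'C(k * k.+1, k)%:R)).
    by rewrite ler_wpM2r.
  apply: bin_sub_ge.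
  - by rewrite leq_pmulr.
  - by rewrite x0 /=; lra.
  - by rewrite mulnS addKn natrM -/K -expr2 xK2.
have aK3 : K * (K + 1) <= expR (3 * L).
  have -> : expR (3 * L) = K ^+ 3 by rewrite expRM_natl KE.
  have : 2 <= K by nra.
  by move=> K2; rewrite exprS ler_pM2l // expr2; nra.
have small : (#|{: A}|%:R * 2^-1 ^+ (3 * q) * (1 + k%:R / #|{: A}|%:R) ^+ N +
   #|{: A}|%:R ^+ s * 2 ^+ u * (1 - p / 2) ^+ N < 1 :> R).
  rewrite cardA AE -/K.
  have e2 : expR (- 2) <= 3^-1 :> R.
    rewrite expRN lef_pV2 ?posrE ?expR_gt0 //.
    by have := expR_ge1Dx (2 : R); lra.
  have -> : 1 + K / (K * (K + 1)) = 1 + k.+1%:R^-1.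
    by rewrite invfM mulrA divff ?mul1r ?gt_eqF // -natr1.
  (* The exponent is [3L - q/2 <= -7L], as [q >= 20L]. *)
  have first_le : K * (K + 1) * 2^-1 ^+ (3 * q) * (1 + k.+1%:R^-1) ^+ N <= expR (- 2).
    rewrite -mulrA (le_trans (ler_pM _ _ aK3 (overload_weight_le R q (ltn0Sn k)))) //.
    - by rewrite mulr_ge0 // ltW // addr_gt0.
    - by rewrite -expRD ler_expR; lra.
  (* The exponent is at most [3KL^2 + pN/4 - pN/2 <= -2KL^2], as [pN >= 20KL^2]. *)
  have second_le : (K * (K + 1)) ^+ s * 2 ^+ u * (1 - p / 2) ^+ N <= expR (- 2).
    rewrite (le_trans (missing_weight_le s u N _ aK3 (ltW p0) p1)) //.
      by rewrite mulr_ge0 // ltW // addr_gt0.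
    rewrite ler_expR.
    have sL : s%:R * (3 * L) <= 3 * (K * L ^+ 2).
      have : s%:R * L <= (1 - 2 * g) * K * L * L by rewrite ler_wpM2r //; lra.
      have : 0 <= g * (K * L ^+ 2) by rewrite !mulr_ge0 ?exprn_ge0 //; lra.
      by rewrite expr2; lra.
    have KL1 : 1 <= K * L ^+ 2 by nra.
    by lra.
  by apply: le_lt_trans (lerD first_le second_le) _; clear first_le second_le; lra.
have kA : (0 < k <= #|{: A}|)%N by rewrite k0 cardA leq_pmulr.
have {small} [h [hk hd hS]] := ex_neighbourhoods kA p1 hp small.
have reg : kC_regular k C (pendant_graph h).
  apply: (@kC_regular_pendant _ _ _ _ _ (3 * q)) => //.
  - by move=> x; exact: ltnW.
  - exact: ltW.
  - by rewrite natrM -/K; lra.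
have dom : (min_domatic k (ltW hC) <= (k * k.+1) %/ s.+1 + N %/ u.+1)%N.
  apply: leq_trans (domatic_pendant_le hS).
  rewrite /min_domatic; case: ex_minnP => m _; apply.
  by apply/asboolP; exists (pendant_graph h).
have divR (a b : nat) : ((a %/ b.+1)%:R <= a%:R / b.+1%:R :> R).
  by rewrite ler_pdivlMr ?ltr0n // -natrM ler_nat leq_trunc_div.
have part1 : ((k * k.+1) %/ s.+1)%:R * L <= (K + 1) * (1 + 4 * g).
  apply: (@le_trans _ _ ((K * (K + 1)) / ((1 - 2 * g) * K * L) * L)).
    rewrite ler_wpM2r //; first by lra.
    rewrite (le_trans (divR _ _)) // AE ler_wpM2l ?mulr_ge0 //; try lra.
    by rewrite lef_pV2 ?posrE ?ltr0n ?mulr_gt0 //; lra.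
  have -> : K * (K + 1) / ((1 - 2 * g) * K * L) * L = (K + 1) / (1 - 2 * g).
    by field; rewrite !gt_eqF //; lra.
  by rewrite ler_pdivrMr; [nra|lra].
(* There are at most [4/p] such classes, and [4L/p <= gK] because [pK = k^g >= M L^2] and
   [gM >= 4]. *)
have part2 : (N %/ u.+1)%:R * L <= g * K.
  have step : (N %/ u.+1)%:R * (p / 4) <= 1.
    have : (N %/ u.+1)%:R * (p / 4) <= N%:R / u.+1%:R * (p / 4).
      by rewrite ler_wpM2r ?divR // divr_ge0 // ltW.
    move/le_trans; apply.
    by rewrite mulrAC ler_pdivrMr ?ltr0n // mul1r; lra.
  have pgK : L <= p / 4 * (g * K).
    have -> : p / 4 * (g * K) = g / 4 * (p * K) by field.
    rewrite pK; apply: (@le_trans _ _ (g / 4 * (M * L ^+ 2))); last first.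
      by rewrite ler_pM2l //; lra.
    by rewrite expr2; nra.
  apply: le_trans (_ : (N %/ u.+1)%:R * (p / 4 * (g * K)) <= _).
    by rewrite ler_wpM2l.
  by rewrite mulrA ler_piMl // mulr_ge0 // ltW.
apply: (@le_trans _ _ (((k * k.+1) %/ s.+1 + N %/ u.+1)%:R * L)).
  by rewrite ler_wpM2r ?ler_nat //; lra.
(* The excess [1 + 4g] from [K + 1] is absorbed by [gK >= 4L >= 4]. *)
rewrite natrD mulrDl; nra.
Qed.

(** * Passage to the limit *)

Theorem theorem1p2 (R : realType) (C : R) (hC : 1 < C) :
  exists eps : nat -> R,
    eps @ \oo --> (0 : R) /\
    forall k : nat, (1 < k)%N ->
      (min_domatic k (ltW hC))%:R <= k%:R / ln (k%:R : R) * (1 + eps k).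
Proof.
pose ratio k : R := (min_domatic k (ltW hC))%:R * ln k%:R / k%:R.
(* Truncating at 0 leaves only an upper bound on [ratio] to prove for the limit. *)
exists (fun k => Num.max 0 (ratio k - 1)); split; last first.
  move=> k k1; have K0 : 0 < k%:R :> R by rewrite ltr0n ltnW.
  have L0 : 0 < ln k%:R :> R by rewrite ln_gt0 // ltr1n.
  have -> : (min_domatic k (ltW hC))%:R = k%:R / ln k%:R * ratio k :> R.
    by rewrite /ratio; field; rewrite !gt_eqF.
  rewrite ler_pM2l ?divr_gt0 //.
  have : ratio k - 1 <= Num.max 0 (ratio k - 1) by rewrite le_max lexx orbT.
  by lra.
apply/cvgrPdist_le => e e0.
pose g := Num.min e 1 / 8.
have g0 : 0 < g by rewrite divr_gt0 // lt_min e0 ltr01.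
have ge : 8 * g <= e.
  by have : Num.min e 1 <= e by [rewrite ge_min lexx]; rewrite /g; lra.
have g8 : g <= 8^-1.
  by have : Num.min e 1 <= 1 by [rewrite ge_min lexx orbT]; rewrite /g; lra.
pose c := (C - 1) / 6; have c0 : 0 < c by rewrite divr_gt0 // subr_gt0.
pose M := 20 / c + 4 / g.
have cM : 20 <= c * M.
  have -> : c * M = 20 + 4 * (c / g) by rewrite /M; field; rewrite !gt_eqF.
  by rewrite lerDl mulr_ge0 // divr_ge0 // ltW.
have gM : 4 <= g * M.
  have -> : g * M = 4 + 20 * (g / c) by rewrite /M; field; rewrite !gt_eqF.
  by rewrite lerDl mulr_ge0 // divr_ge0 // ltW.
have M0 : 0 < M by rewrite addr_gt0 // divr_gt0.
(* From [expR y >= y^3 / 6] at [y = g ln k], the growth condition on [k] holds once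
   [ln k >= 6M / g^3]. *)
pose L0 := 1 + 6 * M / g ^+ 3.
exists (Num.truncn (expR L0)).+1 => //= k /= Kk.
have K0 : 0 < k%:R :> R by rewrite ltr0n (leq_ltn_trans _ Kk).
have L0L : L0 <= ln k%:R :> R.
  rewrite -ler_expR lnK // ltW // (lt_le_trans (truncnS_gt _)) //.
  by rewrite ler_nat.
have MgL0 : 0 <= 6 * M / g ^+ 3 by rewrite !mulr_ge0 ?invr_ge0 ?exprn_ge0 // ltW.
have L1 : 1 <= ln k%:R :> R by rewrite (le_trans _ L0L) // lerDl.
have ML : M * ln k%:R ^+ 2 <= expR (g * ln k%:R) :> R.
  have gL0 : 0 <= g * ln k%:R by rewrite mulr_ge0 ?ltW //; lra.
  apply: le_trans (_ : (g * ln k%:R) ^+ 3 / 6 <= _); last first.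
    by have := expR_ge1Dxn 2 gL0; rewrite (_ : 3`! = 6%N) //; lra.
  rewrite ler_pdivlMr // (_ : _ * 6 = 6 * M * ln k%:R ^+ 2); last by ring.
  rewrite (_ : (_ * _) ^+ 3 = ln k%:R * g ^+ 3 * ln k%:R ^+ 2); last by ring.
  rewrite ler_wpM2r ?exprn_ge0 //; first by lra.
  rewrite -ler_pdivrMr ?exprn_gt0 //.
  by rewrite (le_trans _ L0L) // /L0; lra.
have := @min_domatic_ln_le R C g M hC k.
rewrite g0 g8 => /(_ isT cM gM L1 ML) bound.
rewrite sub0r normrN ger0_norm ?le_max ?lexx // ge_max (ltW e0) /= lerBlDr.
rewrite /ratio ler_pdivrMr // (le_trans bound) // mulrC ler_wpM2r ?ltW //.
by lra.
Qed.
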